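(* For every integer $n\ge 1$, the descent generating function of tieless parking functions of length $n$ has the expansion $$\sum_{\rho\in \mathrm{NT}_n} x^{\mathrm{des}(\rho)}=\sum_{\rho\in\widetilde{\mathrm{PF}}_n} x^{\mathrm{wdes}(\rho)}(x+1)^{n-2\,\mathrm{wdes}(\rho)-1}.$$ In particular, the polynomial $\sum_{\rho\in \mathrm{NT}_n} x^{\mathrm{des}(\rho)}$ is $\gamma$-positive and its coefficients form a unimodal sequence.
   Context: Notation: $[n]=\{1,\dots,n\}$. A parking function of length $n$ is a function $\rho:[n]\to[n]$, identified with the tuple $(\rho_1,\dots,\rho_n)$, such that $\#\rho^{-1}([k])\ge k$ for all $1\le k\le n$. $\mathrm{PF}_n$ is the set of these. For $\rho\in\mathrm{PF}_n$, $\mathrm{des}(\rho)$ is the number of $i\in[n-1]$ with $\rho_i>\rho_{i+1}$, and $\mathrm{wdes}(\rho)$ is the number of $i\in[n-1]$ with $\rho_i\ge\rho_{i+1}$. $\mathrm{NT}_n\subseteq\mathrm{PF}_n$ is the set of tieless parking functions: those with $\rho_i\neq\rho_{i+1}$ for all $i\in[n-1]$. $\widetilde{\mathrm{PF}}_n\subseteq \mathrm{PF}_n$ is the set of parking functions $\rho$ with no consecutive weak descents: with the convention $\rho_0=0=\rho_{n+1}$, there is no $i\in[n]$ such that $\rho_{i-1}\ge\rho_i\ge\rho_{i+1}$. A polynomial $f(x)=\sum_{i=0}^d a_ix^i\in\mathbb{R}[x]$ of degree $d$ is palindromic if $a_i=a_{d-i}$ for all $i$; it is $\gamma$-positive if it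 is palindromic and can be written $f(x)=\sum_{i=0}^{\lfloor d/2\rfloor}\gamma_i x^i(x+1)^{d-2i}$ with all $\gamma_i\ge 0$ real; it is unimodal (its coefficients form a unimodal sequence) if there is an index $j$ with $a_0\le a_1\le\cdots\le a_j\ge a_{j+1}\ge\cdots\ge a_d$. *)

(* Defs.v *)
From HB Require Import structures.
From mathcomp Require Import all_boot all_order all_algebra.
From mathcomp Require Import reals.

Set Implicit Arguments.
Unset Strict Implicit.
Unset Printing Implicit Defensive.

Import Order.TTheory GRing.Theory Num.Theory.

(* A function [n] -> [n] is represented by [rho : {ffun 'I_n -> 'I_n}], where
   the ordinal [i : 'I_n] stands for the element i + 1 of [n], both in the
   domain and in the codomain.  [entry rho i] is rho_i in the 1-based
   convention, extended by rho_0 = 0 = rho_{n+1}: index 0 is the prepended 0,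
   and index n + 1 falls on the default value of [nth]. *)
Definition entry (n : nat) (rho : {ffun 'I_n -> 'I_n}) (i : nat) : nat :=
  nth 0 (0 :: [seq (rho j).+1 | j <- enum 'I_n]) i.

Definition is_parking (n : nat) (rho : {ffun 'I_n -> 'I_n}) : bool :=
  [forall k : 'I_n.+1,
     (1 <= k) ==> (k <= #|[set i : 'I_n | (rho i).+1 <= k]|)].

Definition PF (n : nat) : {set {ffun 'I_n -> 'I_n}} :=
  [set rho | is_parking rho].

Definition des (n : nat) (rho : {ffun 'I_n -> 'I_n}) : nat :=
  count (fun i => entry rho i > entry rho i.+1) (index_iota 1 n).

Definition wdes (n : nat) (rho : {ffun 'I_n -> 'I_n}) : nat :=
  count (fun i => entry rho i >= entry rho i.+1) (index_iota 1 n).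

Definition NT (n : nat) : {set {ffun 'I_n -> 'I_n}} :=
  [set rho in PF n |
     all (fun i => entry rho i != entry rho i.+1) (index_iota 1 n)].

(* Since entry rho (n + 1) = 0, a member has no weak descent at n - 1, so its
   weak descents are pairwise non-adjacent elements of [n - 2]; hence
   2 * wdes rho + 1 <= n when n >= 1. *)
Definition PFtilde (n : nat) : {set {ffun 'I_n -> 'I_n}} :=
  [set rho in PF n |
     ~~ has (fun i => (entry rho i.-1 >= entry rho i) &&
                      (entry rho i >= entry rho i.+1))
            (index_iota 1 n.+1)].

Local Open Scope ring_scope.

Definition degree (R : realType) (f : {poly R}) : nat := (size f).-1.

Definition palindromic (R : realType) (f : {poly R}) : Prop :=
  forall i : nat, (i <= degree f)%N -> f`_i = f`_(degree f - i).

Definition gamma_positive (R : realType) (f : {poly R}) : Prop :=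
  palindromic f /\
  exists g : nat -> R,
    (forall i : nat, (i <= (degree f)./2)%N -> 0 <= g i) /\
    f = \sum_(0 <= i < (degree f)./2.+1)
          g i *: ('X^i * ('X + 1) ^+ (degree f - 2 * i)).

Definition unimodal (R : realType) (f : {poly R}) : Prop :=
  exists j : nat,
    [/\ (j <= degree f)%N,
        forall i : nat, (i < j)%N -> f`_i <= f`_i.+1
      & forall i : nat, (j <= i < degree f)%N -> f`_i.+1 <= f`_i].

(* Main.v *)
Require Import Defs.
From mathcomp Require Import all_boot all_order all_algebra.
From mathcomp Require Import reals.
From mathcomp Require Import ring zify.
From mathcomp Require Import mpoly.
Set Implicit Arguments.
Unset Strict Implicit.
Unset Printing Implicit Defensive.
Import Order.TTheory GRing.Theory Num.Theory.
Local Open Scope ring_scope.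

(** Whether a word is a parking function depends only on its content (how often
    each letter occurs), so it suffices to prove the expansion content by
    content.  Attach commuting variables x_a to the letters a and let e_k be the
    elementary symmetric functions of the x_a, and [k] = 1 + t + ... + t^(k-1).
    Let S_n be the sum of t^des x^content over all tieless words of length n,
    and R_n the sum of t^wdes (1+t)^(n-1-2 wdes) x^content over all words of
    length n without consecutive weak descents.  Both satisfy the recursion
      F_n = [n] e_n + sum_(2 <= k < n) t [k-1] e_k F_(n-k)
    ([smirnov_rec] and [tilde_rec]), hence S_n = R_n ([eq_smirnov_tilde]).

    Both recursions come from reading words by their last letter j.  Write
    s_n(j), r_n(j) for the sums over the words ending in j.

    For S, a pair of adjacent letters i, j weighs
      t + (1-t) [i < j] - t [i = j],
    so s_(n+1) is an explicit linear function of s_n.  Convolving s with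
    t^k e_k turns this into an equation with the same operator as the one that
    defines the polynomials
      p_j(z) = x_j prod_(i < j) (1 + x_i z) prod_(i > j) (1 + t x_i z)
    ([kercoefS]); comparing the two gives [conv_smirnovE].  The identity
      (1-t) z sum_j p_j(z) = prod_i (1 + x_i z) - prod_i (1 + t x_i z)
    then yields the recursion of S_n after summation over j.

    For R, a word without consecutive weak descents whose last two letters are
    a < b is either such a word ending in a, followed by b (a factor 1+t), or
    such a word v followed by a and b, where a does not exceed the last letter
    of v (a factor t).  Writing the latter condition as the difference of no
    condition and the opposite strict inequality leaves only strictly increasing
    segments, which is where e_k appears ([tilde_rec_vec]).

    Taking multivariate polynomials for the ring of coefficients and comparing
    the coefficients of every monomial gives the identity for each content.

    The right-hand side then reads sum_i g_i x^i (1+x)^(n-1-2i), where g_i >= 0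
    counts words and g_0 > 0 because of the identity permutation; palindromicity
    and unimodality follow from those of the binomial coefficients. *)

(** * The common recursion, in commuting variables *)

Section Kernel.

Variables (K : comNzRingType) (x : nat -> K) (m : nat).

(** The polynomial prod_(i < j) (1 + x_i z) prod_(j <= i < m) (1 + t x_i z) in
    the indeterminate z.  It interpolates between the generating polynomials of
    t^k e_k (at j = 0) and of e_k (at j = m). *)
Definition mixprod (t : K) (j : nat) : {poly K} :=
  (\prod_(0 <= i < j) (1 + x i *: 'X)) *
  \prod_(j <= i < m) (1 + (t * x i) *: 'X).

(** The k-th elementary symmetric function of x_0, ..., x_(m-1). *)
Definition elemsym (k : nat) : K := (mixprod 1 0)`_k.

(** The coefficient of z^k in z p_j(z), where
    p_j(z) = x_j prod_(i < j) (1 + x_i z) prod_(j < i < m) (1 + t x_i z).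
    It is the sum over the k-subsets of variables containing x_j, each element
    above x_j being weighted by t.  The shift by one makes it vanish at k = 0.
    At t = 0 it is the sum over the strictly increasing words of length k that
    end in j. *)
Definition kercoef (t : K) (k j : nat) : K :=
  if k is k'.+1 then
    x j * ((\prod_(0 <= i < j) (1 + x i *: 'X)) *
           \prod_(j.+1 <= i < m) (1 + (t * x i) *: 'X))`_k'
  else 0.
Arguments kercoef : simpl never.

Lemma kercoef0 (t : K) (j : nat) : kercoef t 0 j = 0.
Proof. by []. Qed.

(** Moving the variable x_j from one product to the other costs (1 - t) z p_j(z);
    these differences telescope in [coef_mixprod]. *)
Lemma mixprodS (t : K) (j : nat) : (j < m)%N ->
  mixprod t j.+1 = mixprod t j +
    (1 - t) *: (x j *: ('X * ((\prod_(0 <= i < j) (1 + x i *: 'X)) *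
           \prod_(j.+1 <= i < m) (1 + (t * x i) *: 'X)))).
Proof.
move=> jm; rewrite /mixprod big_nat_recr //= [in RHS](big_ltn jm).
rewrite -!mul_polyC !polyCB !polyCM polyC1; ring.
Qed.

Lemma coef_mixprod (t : K) (n j : nat) : (j <= m)%N ->
  (mixprod t j)`_n = (mixprod t 0)`_n + (1 - t) * \sum_(i < j) kercoef t n i.
Proof.
elim: j => [|j IH] jm; first by rewrite big_ord0 mulr0 addr0.
rewrite mixprodS // coefD (IH (ltnW jm)) big_ord_recr /= mulrDr addrA /kercoef.
by rewrite !coefZ coefXM; case: n {IH} => [|n] //=; rewrite mulr0.
Qed.

(** The linear recursion that characterizes [kercoef]: it involves the same
    operator as the transfer of tieless words by their last letter. *)
Lemma kercoefS (t : K) (n j : nat) : (j < m)%N ->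
  kercoef t n.+1 j = x j * ((mixprod t 0)`_n +
     (1 - t) * \sum_(i < j) kercoef t n i - t * kercoef t n j).
Proof.
move=> jm; rewrite -coef_mixprod ?(ltnW jm) //.
rewrite /kercoef /mixprod (big_ltn jm) mulrCA.
rewrite mulrDl mul1r -scalerAl coefD coefZ coefXM.
case: n => [|n] /=; first by ring.
ring.
Qed.

Lemma mixprod0 (t : K) :
  mixprod t 0 = \prod_(0 <= i < m) (1 + (t * x i) *: 'X).
Proof. by rewrite /mixprod big_nil mul1r. Qed.

Lemma coef_mixprod0 (t : K) (k : nat) : (mixprod t 0)`_k = t ^+ k * elemsym k.
Proof.
rewrite /elemsym !mixprod0.
elim: m k => [|M IH] k.
  rewrite !big_geq // coef1.
  by case: k => [|k]; rewrite /= ?mulr0 // expr0 mul1r.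
rewrite !big_nat_recr //= !mulrDr !mulr1 -!scalerAr !coefD !coefZ !coefMX IH.
by case: k => [|k] /=; rewrite ?IH ?exprS; ring.
Qed.

Lemma elemsym0 : elemsym 0 = 1.
Proof.
rewrite /elemsym mixprod0.
elim: m => [|M IH]; first by rewrite big_geq // coef1.
rewrite big_nat_recr //= mulrDr mulr1 -scalerAr coefD coefZ coefMX IH.
by rewrite mulr0 addr0.
Qed.

Lemma mixprodm (t : K) (k : nat) : (mixprod t m)`_k = elemsym k.
Proof.
rewrite /elemsym mixprod0 /mixprod [X in _ * X]big_geq // mulr1.
by under [in RHS]eq_bigr => i _ do rewrite mul1r.
Qed.

Lemma sum_kercoef (t : K) (k : nat) :
  (1 - t) * \sum_(i < m) kercoef t k i = (1 - t ^+ k) * elemsym k.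
Proof.
have := coef_mixprod t k (leqnn m); rewrite mixprodm coef_mixprod0 => H.
by apply/eqP; rewrite [X in _ == X]mulrBl mul1r eq_sym subr_eq addrC -H.
Qed.

(** The t-analogue [k] = 1 + t + ... + t^(k-1) of k. *)
Definition qint (t : K) (k : nat) : K := \sum_(i < k) t ^+ i.

Lemma qint0 (t : K) : qint t 0 = 0.
Proof. by rewrite /qint big_ord0. Qed.

Lemma qintSr (t : K) (k : nat) : qint t k.+1 = qint t k + t ^+ k.
Proof. by rewrite /qint big_ord_recr. Qed.

Lemma qintE (t : K) (k : nat) : (1 - t) * qint t k = 1 - t ^+ k.
Proof.
elim: k => [|k IH]; first by rewrite /qint big_ord0 mulr0 expr0 subrr.
by rewrite qintSr mulrDr IH exprS; ring.
Qed.

(** ** Tieless words *)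

Section SmirnovRecursion.

(** [s n j] plays the role of the sum over the tieless words of length n that
    end in j; the term [(n == 0)%:R] creates the one-letter words. *)
Variables (t : K) (s : nat -> nat -> K).
Hypothesis s0 : forall j, s 0 j = 0.
Hypothesis sS : forall n j, (j < m)%N ->
  s n.+1 j = x j * ((n == 0)%:R + t * (\sum_(i < m) s n i)
                    + (1 - t) * (\sum_(i < j) s n i) - t * s n j).

Let S n := \sum_(i < m) s n i.
Let c k := t ^+ k * elemsym k.
Let u n j := \sum_(k < n.+1) c k * s (n - k) j.

Lemma conv_smirnovS (n j : nat) : (j < m)%N ->
  u n.+1 j = x j * (c n + t * (\sum_(i < m) u n i)
                    + (1 - t) * (\sum_(i < j) u n i) - t * u n j).
Proof.
move=> jm; rewrite /u big_ord_recr /= subnn s0 mulr0 addr0.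
have E (k : 'I_n.+1) : c k * s (n.+1 - k) j = c k * (x j *
    ((n <= k)%N%:R + t * (\sum_(i < m) s (n - k) i)
     + (1 - t) * (\sum_(i < j) s (n - k) i) - t * s (n - k) j)).
  by rewrite (subSn (leq_ord k)) sS // subn_eq0.
rewrite (eq_bigr _ (fun k _ => E k)) {E}.
have ->: c n = \sum_(k < n.+1) c k * ((n <= k)%N%:R : K).
  rewrite big_ord_recr /= leqnn mulr1 big1 ?add0r // => i _.
  by rewrite leqNgt ltn_ord mulr0.
rewrite exchange_big [X in _ + (1 - t) * X]exchange_big /=.
rewrite !mulr_sumr -!sumrN -!big_split /= mulr_sumr.
apply: eq_bigr => k _; rewrite -!mulr_sumr; ring.
Qed.

(** Both sides obey the same recursion in n, by [conv_smirnovS] and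
    [kercoefS]. *)
Lemma conv_smirnovE (n j : nat) : (j < m)%N ->
  u n j = kercoef t n j + t * \sum_(k < n.+1) kercoef t k j * S (n - k).
Proof.
elim: n j => [|n IH] j jm.
  by rewrite /u !big_ord1 /= s0 kercoef0 mul0r !mulr0 addr0.
rewrite conv_smirnovS // (IH j jm).
have ->: \sum_(i < j) u n i = \sum_(i < j)
    (kercoef t n i + t * \sum_(k < n.+1) kercoef t k i * S (n - k)).
  by apply: eq_bigr => i _; apply: IH; apply: ltn_trans jm.
have ->: \sum_(i < m) u n i = \sum_(k < n.+1) c k * S (n - k).
  by rewrite /u exchange_big; apply: eq_bigr => k _; rewrite mulr_sumr.
rewrite [in RHS]big_ord_recl kercoef0 mul0r add0r [in RHS]kercoefS //.
rewrite coef_mixprod0.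
rewrite -/(c n) big_split /=.
rewrite -[in LHS]mulr_sumr exchange_big /=.
have ->: \sum_(i < n.+1) kercoef t (bump 0 i) j * S (n.+1 - bump 0 i) =
   x j * (\sum_(k < n.+1) c k * S (n - k)
     + (1 - t) * (\sum_(k < n.+1) \sum_(i < j) kercoef t k i * S (n - k))
     - t * (\sum_(k < n.+1) kercoef t k j * S (n - k))).
  rewrite !mulr_sumr -sumrN -!big_split /= mulr_sumr.
  apply: eq_bigr => k _; rewrite -mulr_suml /bump leq0n add1n subSS.
  by rewrite kercoefS // coef_mixprod0 -/(c k); ring.
ring.
Qed.

(** Cancelling 1 - t is what identifies the sum of [kercoef t k j] over j with
    [k] e_k. *)
Hypothesis t1 : GRing.lreg (1 - t).

Lemma smirnov_rec (n : nat) :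
  S n = qint t n * elemsym n
        + \sum_(k < n) t * qint t k * elemsym k.+1 * S (n.-1 - k).
Proof.
have A k : \sum_(j < m) kercoef t k j = qint t k * elemsym k.
  by apply: t1; rewrite sum_kercoef mulrA qintE.
have : \sum_(j < m) u n j = qint t n * elemsym n
        + t * \sum_(k < n.+1) qint t k * elemsym k * S (n - k).
  have -> : \sum_(k < n.+1) qint t k * elemsym k * S (n - k)
          = \sum_(j < m) \sum_(k < n.+1) kercoef t k j * S (n - k).
    by rewrite exchange_big; apply: eq_bigr => k _; rewrite -mulr_suml A.
  rewrite -A mulr_sumr -big_split /=.
  by apply: eq_bigr => j _; apply: conv_smirnovE.
rewrite /u exchange_big /=; under eq_bigr => k _ do rewrite -mulr_sumr -/(S _).
rewrite !big_ord_recl /= subn0 {1}/c elemsym0 expr0 !mul1r.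
rewrite qint0 !mul0r add0r => /eqP.
rewrite -subr_eq0 => /eqP H; apply/eqP; rewrite -subr_eq0 -[X in _ == X]H.
apply/eqP; rewrite -!addrA; congr (_ + _).
have ->: \sum_(i < n) c (bump 0 i) * S (n - bump 0 i) =
   \sum_(i < n) t * (qint t (bump 0 i) * elemsym (bump 0 i) * S (n - bump 0 i))
  - \sum_(k < n) t * qint t k * elemsym k.+1 * S (n.-1 - k).
  rewrite -sumrB; apply: eq_bigr => i _; rewrite /bump add1n.
  have ->: (n - i.+1)%N = (n.-1 - i)%N by lia.
  by rewrite /c qintSr exprS; ring.
rewrite -mulr_sumr; ring.
Qed.

End SmirnovRecursion.

(** ** Words without consecutive weak descents *)

Section TildeRecursion.

(** [r n j] plays the role of the weighted sum over the words of length n,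
    ending in j, without consecutive weak descents. *)
Variables (t : K) (r : nat -> nat -> K).
Hypothesis r0 : forall j, r 0 j = 0.
Hypothesis r1 : forall j, (j < m)%N -> r 1 j = x j.
Hypothesis rS : forall n j, (j < m)%N ->
  r n.+2 j = x j * \sum_(i < j) ((1 + t) * r n.+1 i
     + t * x i * (\sum_(h < m) r n h - \sum_(h < i) r n h)).

Let R n := \sum_(i < m) r n i.
Let l := kercoef 0.

(** After inclusion-exclusion on the weak descents, the summand of index k counts
    the words ending with a strictly increasing segment of length k + 1 that
    follows, without any condition at the junction, a word of the same kind.
    The coefficients t [k] solve the three-term relation
    [k+1] = (1+t) [k] - t [k-1]. *)
Lemma tilde_rec_vec (n j : nat) : (j < m)%N ->
  r n j = qint t n * l n j
          + \sum_(k < n) t * qint t k * R (n.-1 - k) * l k.+1 j.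
Proof.
have lS k i : (i < m)%N -> l k.+2 i = x i * \sum_(h < i) l k.+1 h.
  move=> im; rewrite /l kercoefS // coef_mixprod0 exprS !mul0r !subr0 mul1r.
  by rewrite add0r.
have l1 i : (i < m)%N -> l 1 i = x i.
  move=> im; rewrite /l kercoefS // coef_mixprod0 expr0 elemsym0.
  by rewrite kercoef0 big1 // !mulr0 !addr0 subr0 !mulr1.
have q0 := qint0 t.
elim: {n}n.+1 {-2}n (ltnSn n) j => // N IH [|[|n]] nN j jm.
- by rewrite r0 q0 mul0r big_ord0 addr0.
- by rewrite r1 // big_ord_recr big_ord0 /= q0 qintSr q0 l1 //; ring.
have L k i : (i < m)%N -> qint t k * (x i * \sum_(h < i) l k h)
    = qint t k * l k.+1 i.
  by case: k => [|k] im; [rewrite q0 !mul0r | rewrite lS].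
have Lr p i : (p < N)%N -> (i < m)%N -> x i * (\sum_(h < i) r p h) =
    qint t p * l p.+1 i
    + \sum_(k < p) t * qint t k * R (p.-1 - k) * l k.+2 i.
  move=> pN im; rewrite (eq_bigr (fun h : 'I_i => qint t p * l p h
          + \sum_(k < p) t * qint t k * R (p.-1 - k) * l k.+1 h)); last first.
    by move=> h _; apply: IH => //; apply: ltn_trans im.
  rewrite big_split /= mulrDr -mulr_sumr mulrCA L //; congr (_ + _).
  rewrite exchange_big mulr_sumr; apply: eq_bigr => k _ /=.
  by rewrite -mulr_sumr lS //; ring.
(* The sums over h < i produce a double strict transfer of [r n]; the
   unrestricted sum [R n] contributes only to the run of length 2. *)
rewrite rS // big_split /= mulrDr -mulr_sumr mulrCA Lr //.
have ->: \sum_(i < j) t * x i * (\sum_(h < m) r n h - \sum_(h < i) r n h) =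
   t * R n * \sum_(i < j) l 1 i - t * (\sum_(i < j) (qint t n * l n.+1 i
    + \sum_(k < n) t * qint t k * R (n.-1 - k) * l k.+2 i)).
  rewrite [X in X - _]mulr_sumr [X in _ - X]mulr_sumr -sumrB.
  apply: eq_bigr => i _.
  have im : (i < m)%N by apply: ltn_trans jm.
  by rewrite -Lr ?l1 //; [rewrite /R; ring | lia].
rewrite big_split /= [x j * (_ - _)]mulrBr.
have ->: x j * (t * R n * (\sum_(i < j) l 1 i)) = t * R n * l 2 j.
  by rewrite lS //; ring.
rewrite exchange_big /=.
have ->: x j * (t * (\sum_(i < j) qint t n * l n.+1 i
     + \sum_(k < n) \sum_(i < j) t * qint t k * R (n.-1 - k) * l k.+2 i))
   = t * (qint t n * l n.+2 j
     + \sum_(k < n) t * qint t k * R (n.-1 - k) * l k.+3 j).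
  rewrite !mulrDr -!mulr_sumr !lS // mulrCA; congr (_ + _); first by ring.
  rewrite mulrCA; congr (_ * _); rewrite mulr_sumr; apply: eq_bigr => k _.
  by rewrite -mulr_sumr lS //; ring.
rewrite [X in _ = _ + X]big_ord_recl [X in _ = _ + (_ + X)]big_ord_recl.
rewrite [X in (1 + t) * (_ + X)]big_ord_recl /= !q0 !subn0 /bump /= !add1n.
rewrite !qintSr q0 subn1 /=.
(* The three-term relation of [qint], run length by run length. *)
have ->: \sum_(i < n) t * qint t (1 + (1 + i)) * R (n.+1 - (1 + (1 + i)))
       * l (1 + (1 + i)).+1 j =
  (1 + t) * (\sum_(i < n) t * qint t (1 + i) * R (n - (1 + i)) * l (1 + i).+2 j)
  - t * (\sum_(k < n) t * qint t k * R (n.-1 - k) * l k.+3 j).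
  rewrite !mulr_sumr -sumrB; apply: eq_bigr => i _; rewrite !add1n.
  have ->: (n.+1 - i.+2)%N = (n.-1 - i)%N by lia.
  have ->: (n - i.+1)%N = (n.-1 - i)%N by lia.
  by rewrite !qintSr exprS; ring.
by rewrite exprS; ring.
Qed.

Lemma tilde_rec (n : nat) :
  R n = qint t n * elemsym n
        + \sum_(k < n) t * qint t k * elemsym k.+1 * R (n.-1 - k).
Proof.
have E k : \sum_(j < m) l k.+1 j = elemsym k.+1.
  by have := sum_kercoef 0 k.+1; rewrite exprS mul0r subr0 !mul1r.
rewrite {1}/R (eq_bigr (fun j : 'I_m => qint t n * l n j
    + \sum_(k < n) t * qint t k * R (n.-1 - k) * l k.+1 j)); last first.
  by move=> j _; apply: tilde_rec_vec.
rewrite big_split exchange_big /= -mulr_sumr; congr (_ + _).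
  by case: n => [|n]; rewrite ?E // qint0 !mul0r.
by apply: eq_bigr => k _; rewrite -mulr_sumr E mulrAC.
Qed.

End TildeRecursion.

Lemma eq_smirnov_tilde (t : K) (s r : nat -> nat -> K) :
  GRing.lreg (1 - t) ->
  (forall j, s 0 j = 0) ->
  (forall n j, (j < m)%N ->
    s n.+1 j = x j * ((n == 0)%:R + t * (\sum_(i < m) s n i)
                      + (1 - t) * (\sum_(i < j) s n i) - t * s n j)) ->
  (forall j, r 0 j = 0) -> (forall j, (j < m)%N -> r 1 j = x j) ->
  (forall n j, (j < m)%N ->
    r n.+2 j = x j * \sum_(i < j) ((1 + t) * r n.+1 i
       + t * x i * (\sum_(h < m) r n h - \sum_(h < i) r n h))) ->
  forall n, \sum_(i < m) s n i = \sum_(i < m) r n i.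
Proof.
move=> t1 s0 sS r0 r1 rS n.
elim: {n}n.+1 {-2}n (ltnSn n) => // N IH n nN.
rewrite (smirnov_rec s0 sS t1) (tilde_rec r0 r1 rS); congr (_ + _).
by apply: eq_bigr => k _; rewrite IH //; have := ltn_ord k; lia.
Qed.

End Kernel.

(** * Words and their last letters *)

Section Words.
Local Open Scope nat_scope.
Implicit Types (w v : seq nat).

(** The letters of a word are positive integers; the i-th letter (from 1) of [w]
    is extended by 0 at index 0 and beyond the end of the word. *)
Definition letter w i := nth 0 (0 :: w) i.

Definition wordDes w :=
  count (fun i => letter w i > letter w i.+1) (index_iota 1 (size w)).

Definition wordWdes w :=
  count (fun i => letter w i >= letter w i.+1) (index_iota 1 (size w)).

Definition tieless w :=
  all (fun i => letter w i != letter w i.+1) (index_iota 1 (size w)).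

(** Two consecutive weak descents around position i. *)
Definition dwdes w i :=
  (letter w i.-1 >= letter w i) && (letter w i >= letter w i.+1).

(** No consecutive weak descents, the final 0 included. *)
Definition isTilde w := ~~ has (dwdes w) (index_iota 1 (size w).+1).

(** No consecutive weak descents strictly inside the word, where the 0 after the
    last letter is ignored. *)
Definition isTildeIn w := ~~ has (dwdes w) (index_iota 1 (size w)).

(** The last step of the word is a weak descent.  For a one-letter word the step
    comes from the initial 0 and is an ascent. *)
Definition endsWdes w := letter w (size w).-1 >= last 0 w.

Lemma iota1S n : 0 < n -> index_iota 1 n.+1 = rcons (index_iota 1 n) n.
Proof.
case: n => // p _; rewrite /index_iota !subSS !subn0.
by rewrite -[in LHS](addn1 p) (iotaD 1 p 1) cats1 add1n.
Qed.

Lemma letter_rcons w a i : i <= size w -> letter (rcons w a) i = letter w i.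
Proof. by case: i => //= i iw; rewrite /letter /= nth_rcons iw. Qed.

Lemma letter_rconsS w a : letter (rcons w a) (size w).+1 = a.
Proof. by rewrite /letter /= nth_rcons ltnn eqxx. Qed.

Lemma letter_size w : letter w (size w) = last 0 w.
Proof. by rewrite /letter (last_nth 0). Qed.

Lemma mem_iota1 n i : i \in index_iota 1 n -> 0 < i < n.
Proof. by rewrite mem_index_iota. Qed.

Lemma wordDes_rcons w a : wordDes (rcons w a) = wordDes w + (last 0 w > a).
Proof.
rewrite /wordDes size_rcons; have [/size0nil -> //|w0] := posnP (size w).
rewrite iota1S // -(cats1 (index_iota _ _)) count_cat /= addn0.
rewrite letter_rconsS letter_rcons //.
rewrite letter_size; congr (_ + _).
apply: eq_in_count => i /mem_iota1 /andP[_ iw].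
by rewrite !letter_rcons // ltnW.
Qed.

Lemma wordWdes_rcons w a : 0 < a ->
  wordWdes (rcons w a) = wordWdes w + (last 0 w >= a).
Proof.
move=> a0; rewrite /wordWdes size_rcons.
have [/size0nil -> |w0] := posnP (size w).
  by case: a a0.
rewrite iota1S // -(cats1 (index_iota _ _)) count_cat /= addn0.
rewrite letter_rconsS letter_rcons //.
rewrite letter_size; congr (_ + _).
apply: eq_in_count => i /mem_iota1 /andP[_ iw].
by rewrite !letter_rcons // ltnW.
Qed.

Lemma tieless_rcons w a : 0 < a ->
  tieless (rcons w a) = tieless w && (last 0 w != a).
Proof.
move=> a0; rewrite /tieless size_rcons.
have [/size0nil -> |w0] := posnP (size w).
  by case: a a0.
rewrite iota1S // all_rcons andbC letter_rconsS letter_rcons // letter_size.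
congr (_ && _); apply: eq_in_all => i /mem_iota1 /andP[_ iw].
by rewrite !letter_rcons // ltnW.
Qed.

Lemma isTildeIn_rcons w a : 0 < a ->
  isTildeIn (rcons w a) = isTildeIn w && ~~ (endsWdes w && (last 0 w >= a)).
Proof.
move=> a0; rewrite /isTildeIn size_rcons.
have [/size0nil -> |w0] := posnP (size w).
  by case: a a0.
rewrite iota1S // has_rcons negb_or andbC; congr (~~ _ && ~~ _).
  apply: eq_in_has => i /mem_iota1 /andP[_ iw].
  by rewrite /dwdes !letter_rcons ?(leq_trans (leq_pred _)) // ltnW.
rewrite /dwdes letter_rconsS !letter_rcons ?leq_pred // letter_size.
by rewrite /endsWdes.
Qed.

Lemma endsWdes_rcons w a : endsWdes (rcons w a) = (last 0 w >= a).
Proof.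
by rewrite /endsWdes size_rcons letter_rcons // letter_size last_rcons.
Qed.

Lemma isTildeE w : 0 < size w -> isTilde w = isTildeIn w && ~~ endsWdes w.
Proof.
move=> w0; rewrite /isTilde /isTildeIn iota1S // has_rcons negb_or andbC.
by rewrite /endsWdes /dwdes letter_size [letter w _.+1]nth_default // andbT.
Qed.

Lemma isTilde1 a : 0 < a -> isTilde [:: a].
Proof. by case: a. Qed.

(** The decomposition by the last two letters behind the recursion for words
    without consecutive weak descents. *)
Lemma isTilde_rcons2 w a b : 0 < a -> 0 < b ->
  isTilde (rcons (rcons w a) b) =
  (a < b) && (if last 0 w < a then isTilde (rcons w a) else isTilde w).
Proof.
move=> a0 b0; rewrite isTildeE ?size_rcons // endsWdes_rcons last_rcons.
rewrite isTildeIn_rcons // last_rcons -ltnNge.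
have [ab|] := ltnP a b; last by rewrite andbF.
rewrite andbF !andbT /=.
rewrite isTildeIn_rcons // isTildeE ?size_rcons // isTildeIn_rcons //.
rewrite endsWdes_rcons; have [la|la] := ltnP.
  by rewrite !andbF !andbT.
rewrite andbT isTildeE //; by case: w la => //=; rewrite leqNgt a0.
Qed.

(** This bound makes the truncated subtractions in the exponents of t + 1
    exact. *)
Lemma wdes_isTilde w : all (leq 1) w -> 0 < size w -> isTilde w ->
  2 * wordWdes w < size w.
Proof.
elim: {w}(size w) {-2}w (leqnn (size w)) => [|N IH] w.
  by case: w.
case/lastP: w => // w b; case/lastP: w => [|w a].
  by case: b.
rewrite !size_rcons !all_rcons => wN /and3P[b0 a0 wp] _.
rewrite isTilde_rcons2 // => /andP[ab].
rewrite wordWdes_rcons // last_rcons (leqNgt b a) ab addn0.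
case: ltnP => la tw.
  have := IH (rcons w a); rewrite size_rcons all_rcons a0 => /(_ wN wp isT tw).
  lia.
rewrite wordWdes_rcons // la.
have w0 : 0 < size w by case: w la {wN wp tw} => //=; rewrite leqNgt a0.
have := IH w _ wp w0 tw; lia.
Qed.

End Words.

(** * Weighted sums over words *)

Section Transfer.

Variables (K : comNzRingType) (x : nat -> K) (m : nat).

(** The monomial of a word; the letter a + 1 carries the variable x_a. *)
Definition content w : K := \prod_(a <- w) x a.-1.

(** A word over {0, ..., m-1} as a word over {1, ..., m}. *)
Definition shiftWord n (w : n.-tuple 'I_m) : seq nat :=
  [seq (val i).+1 | i <- w].

(** The sum of [F] over the words of length n with last letter j + 1; there are
    none for n = 0. *)
Definition wordsum (F : seq nat -> K) (n j : nat) : K :=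
  if n is n'.+1 then \sum_(w : n'.-tuple 'I_m) F (rcons (shiftWord w) j.+1)
  else 0.

Lemma big_rcons_tuple n (F : seq nat -> K) :
  \sum_(w : n.+1.-tuple 'I_m) F (shiftWord w) =
  \sum_(j < m) \sum_(w : n.-tuple 'I_m) F (rcons (shiftWord w) j.+1).
Proof.
rewrite pair_big /=.
pose h (p : 'I_m * n.-tuple 'I_m) := [tuple of rcons p.2 p.1].
have hb : bijective h.
  exists (fun w : n.+1.-tuple 'I_m =>
     (tnth w ord_max, [tuple tnth w (widen_ord (leqnSn n) i) | i < n])).
  - move=> [j w] /=; congr (_, _).
      by rewrite (tnth_nth j) /= nth_rcons size_tuple ltnn eqxx.
    apply: eq_from_tnth => i; rewrite tnth_mktuple (tnth_nth j) /=.
    by rewrite nth_rcons size_tuple ltn_ord -tnth_nth.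
  - move=> w; apply: eq_from_tnth => i; rewrite (tnth_nth (tnth w ord_max)) /=.
    rewrite nth_rcons size_map size_enum_ord; case: ltnP => ni.
      pose w' := [tuple tnth w (widen_ord (leqnSn n) k) | k < n].
      transitivity (tnth w' (Ordinal ni)).
        by rewrite [RHS](tnth_nth (tnth w ord_max)).
      by rewrite tnth_mktuple; congr tnth; apply: val_inj.
    have -> : i = ord_max.
      by apply: val_inj; apply/eqP; rewrite eqn_leq ni leq_ord.
    by rewrite eqxx.
rewrite (reindex h) /=; last exact: onW_bij.
by apply: eq_bigr => p _; rewrite /shiftWord /= map_rcons.
Qed.

Lemma sum_wordsum (F : seq nat -> K) n :
  \sum_(j < m) wordsum F n.+1 j = \sum_(w : n.+1.-tuple 'I_m) F (shiftWord w).
Proof. by rewrite big_rcons_tuple. Qed.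

Lemma sum_tuple0 (F : seq nat -> K) :
  \sum_(w : 0.-tuple 'I_m) F (shiftWord w) = F [::].
Proof.
rewrite (big_pred1 [tuple]) ?tuple0 // => w; rewrite [w]tuple0 /=.
by apply/esym/eqP.
Qed.

Lemma wordsum1 (F : seq nat -> K) j : wordsum F 1 j = F [:: j.+1].
Proof. exact: (sum_tuple0 (fun w => F (rcons w j.+1))). Qed.

Lemma wordsumSS (F : seq nat -> K) n j : wordsum F n.+2 j =
  \sum_(i < m) \sum_(w : n.-tuple 'I_m)
    F (rcons (rcons (shiftWord w) i.+1) j.+1).
Proof. exact: (big_rcons_tuple n (fun w => F (rcons w j.+1))). Qed.

Variable t : K.

(** The contribution of a word to the sum S_n over tieless words. *)
Definition smirnovTerm (w : seq nat) : K :=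
  (tieless w)%:R * t ^+ wordDes w * content w.

(** The contribution of a word to the sum R_n over words without consecutive
    weak descents. *)
Definition tildeTerm (w : seq nat) : K :=
  (isTilde w)%:R * (t ^+ wordWdes w * (t + 1) ^+ (size w - 2 * wordWdes w - 1))
  * content w.

Lemma content_rcons w a : content (rcons w a) = content w * x a.-1.
Proof. by rewrite /content big_rcons. Qed.

Lemma smirnovTerm_rcons w i j :
  smirnovTerm (rcons (rcons w i.+1) j.+1) =
  x j * ((i < j)%N%:R + t * (j < i)%N%:R) * smirnovTerm (rcons w i.+1).
Proof.
rewrite /smirnovTerm tieless_rcons // wordDes_rcons content_rcons last_rcons /=.
rewrite ltnS eqSS exprD; case: (ltngtP i j) => [ij|ij|->] /=;
  rewrite ?andbF ?andbT ?mulr0n; ring.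
Qed.

Lemma sum_lt (j : nat) (f : nat -> K) : (j < m)%N ->
  \sum_(i < j) f i = \sum_(i < m) (i < j)%N%:R * f i.
Proof.
move=> jm; rewrite (big_ord_widen m f (ltnW jm)) big_mkcond /=.
by apply: eq_bigr => i _; case: ifP => _; rewrite ?mul1r ?mul0r.
Qed.

Lemma smirnov_transfer n j : (j < m)%N ->
  wordsum smirnovTerm n.+1 j = x j * ((n == 0)%:R
    + t * (\sum_(i < m) wordsum smirnovTerm n i)
    + (1 - t) * (\sum_(i < j) wordsum smirnovTerm n i)
    - t * wordsum smirnovTerm n j).
Proof.
move=> jm; case: n => [|n].
  rewrite wordsum1 /= !big1 // /smirnovTerm /content big_seq1 /=.
  by rewrite !(mulr0, addr0, subr0) expr0 !mul1r mulr1.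
rewrite add0r wordsumSS.
have E (i : 'I_m) :
    \sum_(w : n.-tuple 'I_m) smirnovTerm (rcons (rcons (shiftWord w) i.+1) j.+1)
    = x j * ((i < j)%N%:R + t * (j < i)%N%:R) * wordsum smirnovTerm n.+1 i.
  by rewrite mulr_sumr; apply: eq_bigr => w _; rewrite smirnovTerm_rcons.
rewrite (eq_bigr _ (fun i _ => E i)) {E}.
move: (wordsum smirnovTerm n.+1) => s; rewrite (sum_lt s jm).
have -> : t * s j = \sum_(i < m) t * (i == j :> nat)%:R * s i.
  rewrite (bigD1 (Ordinal jm)) //= eqxx mulr1 big1 ?addr0 // => i.
  by rewrite -val_eqE /= => /negPf ->; rewrite mulr0 mul0r.
rewrite !mulr_sumr -big_split -sumrB /= mulr_sumr; apply: eq_bigr => i _.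
case: (ltngtP i j) => ij /=; ring.
Qed.

(** For empty [w] the default value 0 of [last] makes the second summand vanish,
    as it should: there is then no letter before i + 1. *)
Lemma tildeTerm_rcons w i j : all (leq 1) w ->
  tildeTerm (rcons (rcons w i.+1) j.+1) = x j * (i < j)%N%:R *
   ((1 + t) * tildeTerm (rcons w i.+1)
    + t * x i * (i < last 0%N w)%N%:R * tildeTerm w).
Proof.
move=> wp; rewrite /tildeTerm isTilde_rcons2 // !wordWdes_rcons // last_rcons.
rewrite !content_rcons /= !size_rcons !ltnS.
case: (ltnP i j) => ij /=; last by rewrite mulr0n; ring.
rewrite addn0; case: (leqP (last 0%N w) i) => la.
  rewrite addn0; have [tw|] := boolP (isTilde (rcons w i.+1)); last first.
    by move=> _; rewrite mulr0n; ring.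
  have := @wdes_isTilde (rcons w i.+1).
  rewrite all_rcons wp size_rcons wordWdes_rcons // (ltnNge i (last 0%N w)) la.
  rewrite addn0 => /(_ isT isT tw) wd.
  have -> : ((size w).+2 - 2 * wordWdes w - 1)%N
       = ((size w).+1 - 2 * wordWdes w - 1).+1 by lia.
  by rewrite exprS mulr0n; ring.
rewrite /=; have -> : isTilde (rcons w i.+1) = false.
  by rewrite isTildeE ?size_rcons // endsWdes_rcons la andbF.
have -> : ((size w).+2 - 2 * (wordWdes w + 1) - 1)%N
       = (size w - 2 * wordWdes w - 1)%N by lia.
by rewrite exprD mulr0n; ring.
Qed.

Lemma shiftWord_gt0 n (w : n.-tuple 'I_m) : all (leq 1) (shiftWord w).
Proof. by rewrite all_map; apply/allP. Qed.

Lemma tilde_transfer1 j : wordsum tildeTerm 1 j = x j.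
Proof.
rewrite wordsum1 /tildeTerm isTilde1 // /content big_seq1 /=.
by rewrite !expr0 !mul1r.
Qed.

Lemma tilde_transfer n j : (j < m)%N ->
  wordsum tildeTerm n.+2 j =
  x j * \sum_(i < j) ((1 + t) * wordsum tildeTerm n.+1 i
       + t * x i * (\sum_(h < m) wordsum tildeTerm n h
                    - \sum_(h < i) wordsum tildeTerm n h)).
Proof.
move=> jm; rewrite wordsumSS.
have E (i : 'I_m) :
    \sum_(w : n.-tuple 'I_m) tildeTerm (rcons (rcons (shiftWord w) i.+1) j.+1)
    = x j * ((i < j)%N%:R * ((1 + t) * wordsum tildeTerm n.+1 i
       + t * x i * (\sum_(h < m) wordsum tildeTerm n h
                    - \sum_(h < i) wordsum tildeTerm n h))).
  under eq_bigr => w _ do rewrite (tildeTerm_rcons _ _ (shiftWord_gt0 w)).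
  rewrite -mulr_sumr big_split /= -mulr_sumr -mulrA; congr (_ * (_ * (_ + _))).
  case: n => [|p].
    rewrite (sum_tuple0 (fun w =>
      t * x i * (i < last 0%N w)%N%:R * tildeTerm w)).
    by rewrite /= !big1 // mulr0n; ring.
  rewrite (big_rcons_tuple _
    (fun w => t * x i * (i < last 0%N w)%N%:R * tildeTerm w)).
  rewrite (sum_lt (wordsum tildeTerm p.+1) (ltn_ord i)) -sumrB mulr_sumr.
  apply: eq_bigr => h _; rewrite /wordsum [_ * \sum_(_ : _) _]mulr_sumr -sumrB.
  rewrite mulr_sumr.
  apply: eq_bigr => w _; rewrite last_rcons ltnS.
  by case: (leqP i h) => _ /=; ring.
rewrite (eq_bigr _ (fun i _ => E i)) {E} -mulr_sumr; congr (_ * _).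
pose f i := (1 + t) * wordsum tildeTerm n.+1 i
       + t * x i * (\sum_(h < m) wordsum tildeTerm n h
                    - \sum_(h < i) wordsum tildeTerm n h).
by rewrite -[RHS]/(\sum_(i < j) f i) (sum_lt f jm).
Qed.

(** The identity S_n = R_n. *)
Lemma sum_smirnov_tilde n : (0 < n)%N -> GRing.lreg (1 - t) ->
  \sum_(w : n.-tuple 'I_m) smirnovTerm (shiftWord w) =
  \sum_(w : n.-tuple 'I_m) tildeTerm (shiftWord w).
Proof.
case: n => // n _ t1; rewrite -!sum_wordsum.
apply: (@eq_smirnov_tilde _ x m t
  (wordsum smirnovTerm) (wordsum tildeTerm)) => //.
- by move=> p j jm; apply: smirnov_transfer.
- by move=> j _; apply: tilde_transfer1.
- by move=> p j jm; apply: tilde_transfer.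
Qed.

End Transfer.

(** * Comparing contents *)

Section ContentExtraction.

Variables (R : realType) (p : nat).
Local Notation n := p.+1.
Local Notation K := {mpoly {poly R}[n]}.

(** The variable attached to the letter a + 1. *)
Definition var (a : nat) : K := 'X_(inord a).

(** The content of a word, as the exponent of its monomial. *)
Definition multideg (w : seq 'I_n) : 'X_{1..n} :=
  [multinom count_mem i w | i < n].

Lemma lreg_1subX : GRing.lreg (1 - ('X : {poly R})%:MP : K).
Proof.
apply/lregP; rewrite -mpolyC1 -mpolyCB mpolyC_eq0 subr_eq0.
apply/negP => /eqP/(congr1 (fun q : {poly R} => size q)).
by rewrite size_poly1 size_polyX.
Qed.

Lemma content_multideg k (w : k.-tuple 'I_n) :
  content var (shiftWord w) = 'X_[multideg w].
Proof.
rewrite /content /shiftWord big_map; elim: (tval w) => [|a s IH].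
  suff -> : multideg [::] = 0%MM by rewrite big_nil mpolyX0.
  by apply/mnmP => i; rewrite !mnmE.
have -> : multideg (a :: s) = (U_(a) + multideg s)%MM.
  by apply/mnmP => i; rewrite mnmDE mnm1E !mnmE.
by rewrite big_cons IH /= mpolyXD /var inord_val.
Qed.

Lemma sum_multideg (F : seq nat -> {poly R}) (G : seq nat -> K)
    (k : nat) (c : 'X_{1..n}) :
  (forall w, G w = (F w)%:MP * content var w) ->
  (\sum_(w : k.-tuple 'I_n) G (shiftWord w))@_c =
  \sum_(w : k.-tuple 'I_n | multideg w == c) F (shiftWord w).
Proof.
move=> GF; rewrite raddf_sum [RHS]big_mkcond; apply: eq_bigr => w _ /=.
rewrite GF mcoeffCM content_multideg mcoeffX.
by case: eqP; rewrite ?mulr1 ?mulr0.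
Qed.

(** The contributions of a word to the two sides, without the monomial. *)
Definition smirnovPoly (w : seq nat) : {poly R} :=
  (tieless w)%:R * 'X^(wordDes w).

Definition tildePoly (w : seq nat) : {poly R} :=
  (isTilde w)%:R *
  ('X^(wordWdes w) * ('X + 1) ^+ (size w - 2 * wordWdes w - 1)).

Lemma eq_sum_multideg (k : nat) (c : 'X_{1..n}) : (0 < k)%N ->
  \sum_(w : k.-tuple 'I_n | multideg w == c) smirnovPoly (shiftWord w) =
  \sum_(w : k.-tuple 'I_n | multideg w == c) tildePoly (shiftWord w).
Proof.
move=> k0.
rewrite -(@sum_multideg _ (smirnovTerm var ('X : {poly R})%:MP)); last first.
  by move=> w; rewrite /smirnovTerm /smirnovPoly rmorphM rmorph_nat rmorphXn.
rewrite -(@sum_multideg _ (tildeTerm var ('X : {poly R})%:MP)); last first.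
  move=> w; rewrite /tildeTerm /tildePoly !rmorphM rmorph_nat !rmorphXn.
  by rewrite rmorphD rmorph1.
congr (_ @_ c); exact: sum_smirnov_tilde k0 lreg_1subX.
Qed.

(** The sorted rearrangement, a representative of the words with the same
    content that lives in a finite type. *)
Definition sortWord k (w : k.-tuple 'I_n) : k.-tuple 'I_n :=
  [tuple of sort (fun a b : 'I_n => a <= b)%N w].

Lemma multideg_perm (u v : seq 'I_n) : (multideg u == multideg v) = perm_eq u v.
Proof.
apply/eqP/idP => [E | /permP uv]; last first.
  by apply/mnmP => i; rewrite !mnmE uv.
by apply/allP => a _ /=; move/mnmP/(_ a): E; rewrite !mnmE => ->.
Qed.

Lemma sortWord_perm k (u v : k.-tuple 'I_n) :
  (sortWord u == sortWord v) = perm_eq u v.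
Proof.
rewrite -val_eqE /=; apply/eqP/idP => /perm_sortP; apply.
- by move=> a b; apply: leq_total.
- by move=> a b c; apply: leq_trans.
- by move=> a b; rewrite -eqn_leq => /eqP/val_inj.
- by move=> a b; apply: leq_total.
- by move=> a b c; apply: leq_trans.
- by move=> a b; rewrite -eqn_leq => /eqP/val_inj.
Qed.

(** The identity holds over any set of words closed under rearrangement. *)
Lemma eq_sum_perm_invariant k (P : pred (k.-tuple 'I_n)) : (0 < k)%N ->
  (forall u v : k.-tuple 'I_n, perm_eq u v -> P u = P v) ->
  \sum_(w | P w) smirnovPoly (shiftWord w) =
  \sum_(w | P w) tildePoly (shiftWord w).
Proof.
move=> k0 Pperm.
rewrite (partition_big (@sortWord k) xpredT) //.
rewrite [RHS](partition_big (@sortWord k) xpredT) //; apply: eq_bigr => c _.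
have [w0 /andP[Pw0 /eqP <-]|Q0] := pickP (fun w => P w && (sortWord w == c));
  last by rewrite !big_pred0.
have E w : P w && (sortWord w == sortWord w0) = (multideg w == multideg w0).
  rewrite sortWord_perm multideg_perm; case: (boolP (perm_eq _ _)) => [ww|_].
    by rewrite (Pperm _ _ ww) Pw0.
  by rewrite andbF.
by rewrite !(eq_bigl _ _ E) eq_sum_multideg.
Qed.

End ContentExtraction.

(** * Parking functions as words *)

Section Encoding.

Variable n : nat.
Implicit Type rho : {ffun 'I_n -> 'I_n}.

(** The word rho_1 ... rho_n. *)
Definition ffunWord rho : seq nat := [seq (rho j).+1 | j <- enum 'I_n].

Lemma size_ffunWord rho : size (ffunWord rho) = n.
Proof. by rewrite size_map size_enum_ord. Qed.

Lemma des_ffunWord rho : des rho = wordDes (ffunWord rho).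
Proof. by rewrite /wordDes size_ffunWord. Qed.

Lemma wdes_ffunWord rho : wdes rho = wordWdes (ffunWord rho).
Proof. by rewrite /wordWdes size_ffunWord. Qed.

Lemma in_NT rho : (rho \in NT n) = is_parking rho && tieless (ffunWord rho).
Proof. by rewrite /tieless size_ffunWord !inE. Qed.

Lemma in_PFtilde rho :
  (rho \in PFtilde n) = is_parking rho && isTilde (ffunWord rho).
Proof. by rewrite /isTilde size_ffunWord !inE. Qed.

(** The function [n] -> [n] listed by a tuple. *)
Definition tupleFfun (w : n.-tuple 'I_n) : {ffun 'I_n -> 'I_n} :=
  [ffun i => tnth w i].

Lemma tupleFfun_bij : bijective tupleFfun.
Proof.
exists (fun rho => [tuple rho i | i < n]).
  by move=> w; apply: eq_from_tnth => i; rewrite tnth_mktuple ffunE.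
by move=> rho; apply/ffunP => i; rewrite ffunE tnth_mktuple.
Qed.

Lemma ffunWord_tuple (w : n.-tuple 'I_n) : ffunWord (tupleFfun w) = shiftWord w.
Proof.
rewrite /shiftWord -[X in map _ X]map_tnth_enum -map_comp.
by apply: eq_map => i /=; rewrite ffunE.
Qed.

Lemma is_parking_perm (u v : n.-tuple 'I_n) :
  perm_eq u v -> is_parking (tupleFfun u) = is_parking (tupleFfun v).
Proof.
have E (w : n.-tuple 'I_n) (k : nat) : #|[set i | ((tupleFfun w i).+1 <= k)%N]|
    = count (fun a : 'I_n => a < k)%N w.
  rewrite cardsE cardE size_filter -enumT.
  rewrite -[X in _ = count _ X]map_tnth_enum count_map.
  by apply: eq_count => i; rewrite /= unfold_in ffunE.
move=> /permP uv; apply: eq_forallb => k; by rewrite !E uv.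
Qed.

End Encoding.

Lemma sum_NT_PFtilde (R : realType) (n : nat) : (0 < n)%N ->
  \sum_(rho in NT n) 'X^(des rho) =
  \sum_(rho in PFtilde n)
    'X^(wdes rho) * ('X + 1) ^+ (n - 2 * wdes rho - 1) :> {poly R}.
Proof.
case: n => // p _.
have tb := onW_bij _ (@tupleFfun_bij p.+1).
rewrite (reindex _ (tb _)) [RHS](reindex _ (tb _)) /=.
under eq_bigl => w do rewrite in_NT ffunWord_tuple.
under [RHS]eq_bigl => w do rewrite in_PFtilde ffunWord_tuple.
rewrite !big_mkcondr /=.
have := @eq_sum_perm_invariant R p p.+1 (fun w => is_parking (tupleFfun w)) isT
  (@is_parking_perm p.+1).
congr (_ = _); apply: eq_bigr => w _.
  rewrite des_ffunWord ffunWord_tuple /smirnovPoly.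
  by case: ifP => _; rewrite ?mul1r ?mul0r.
rewrite wdes_ffunWord ffunWord_tuple /tildePoly size_map size_tuple.
by case: ifP => _; rewrite ?mul1r ?mul0r.
Qed.

(** * Palindromicity and unimodality *)

Section Gamma.

Variable R : realType.

Lemma wdes_PFtilde n (rho : {ffun 'I_n -> 'I_n}) : (0 < n)%N ->
  rho \in PFtilde n -> (2 * wdes rho < n)%N.
Proof.
move=> n0; rewrite in_PFtilde wdes_ffunWord => /andP[_ tw].
rewrite -{2}(size_ffunWord rho); apply: wdes_isTilde => //.
  by rewrite all_map; apply/allP.
by rewrite size_ffunWord.
Qed.

(** The polynomial sum_i g_i X^i (X+1)^(d-2i) with i running up to d/2. *)
Definition gammaPoly (d : nat) (g : nat -> R) : {poly R} :=
  \sum_(0 <= i < d./2.+1) g i *: ('X^i * ('X + 1) ^+ (d - 2 * i)).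

Lemma coef_X1n (N k : nat) : (('X + 1 : {poly R}) ^+ N)`_k = 'C(N, k)%:R.
Proof.
rewrite addrC exprDn coef_sum.
have [kN|Nk] := ltnP k N.+1; last first.
  rewrite bin_small // big1 // => i _; rewrite expr1n mul1r coefMn coefXn.
  by rewrite gtn_eqF ?mul0rn // (leq_trans (ltn_ord i)).
rewrite (bigD1 (Ordinal kN)) //= big1 ?addr0 => [|i ik].
  by rewrite expr1n mul1r coefMn coefXn eqxx.
rewrite expr1n mul1r coefMn coefXn.
by rewrite -val_eqE eq_sym in ik; rewrite (negPf ik) mul0rn.
Qed.

Lemma coef_gammaPoly d g k : (gammaPoly d g)`_k =
  \sum_(0 <= i < d./2.+1)
    g i * (if (k < i)%N then 0 else 'C(d - 2 * i, k - i)%:R).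
Proof.
rewrite coef_sum; apply: eq_bigr => i _.
by rewrite coefZ coefXnM coef_X1n.
Qed.

Lemma gammaPoly_sym d g k : (k <= d)%N ->
  (gammaPoly d g)`_k = (gammaPoly d g)`_(d - k).
Proof.
move=> kd; rewrite !coef_gammaPoly big_nat_cond [RHS]big_nat_cond.
apply: eq_bigr => i /andP[/andP[_ id] _]; congr (_ * _).
have i2 : (2 * i <= d)%N by lia.
case: ltnP => ki; case: ltnP => dki //.
- by rewrite bin_small //; lia.
- by rewrite bin_small //; lia.
by rewrite -bin_sub; [congr ('C(_, _)%:R); lia | lia].
Qed.

Lemma size_gammaPoly d g : (0 < g 0)%R -> size (gammaPoly d g) = d.+1.
Proof.
move=> g0; apply/eqP; rewrite eqn_leq; apply/andP; split.
  apply/leq_sizeP => k dk; rewrite coef_gammaPoly big_nat_cond big1 // => i.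
  move=> /andP[/andP[_ id] _]; case: ltnP => ki; first by rewrite mulr0.
  by rewrite bin_small ?mulr0 //; lia.
rewrite ltnNge; apply/negP => /leq_sizeP/(_ d (leqnn d))/eqP.
rewrite gammaPoly_sym // subnn coef_gammaPoly big_nat_recl //.
rewrite muln0 subn0 bin0 mulr1.
by rewrite big1 ?addr0 ?gt_eqF // => i _; rewrite mulr0.
Qed.

Lemma leq_bin_half N k : (2 * k < N)%N -> ('C(N, k) <= 'C(N, k.+1))%N.
Proof.
move=> kN; rewrite -(leq_pmul2l (ltn0Sn k)) mul_bin_left.
by rewrite leq_mul2r; apply/orP; right; lia.
Qed.

Lemma gammaPoly_incr d g k : (forall i, 0 <= g i) -> (2 * k < d)%N ->
  (gammaPoly d g)`_k <= (gammaPoly d g)`_k.+1.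
Proof.
move=> g0 kd; rewrite !coef_gammaPoly; apply: ler_sum_nat => i /andP[_ id].
apply: ler_wpM2l => //; case: ltnP => ki.
  by case: ltnP.
rewrite ltnNge (leq_trans ki) //= ler_nat subSn //.
by apply: leq_bin_half; lia.
Qed.

Lemma gamma_positive_gammaPoly d g : (0 < g 0) -> (forall i, 0 <= g i) ->
  gamma_positive (gammaPoly d g).
Proof.
move=> g0 gp; rewrite /gamma_positive /palindromic /degree size_gammaPoly //=.
split; first by move=> i; apply: gammaPoly_sym.
by exists g.
Qed.

(** The coefficients increase up to d/2 and decrease afterwards by symmetry. *)
Lemma unimodal_gammaPoly d g : (0 < g 0) -> (forall i, 0 <= g i) ->
  unimodal (gammaPoly d g).
Proof.
move=> g0 gp; rewrite /unimodal /degree size_gammaPoly //=.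
exists (d./2); split; first by lia.
  by move=> i id; apply: gammaPoly_incr => //; lia.
move=> i /andP[di id].
(* For odd d the two middle coefficients i and d - i are equal. *)
have [i2|i2] := eqVneq d (2 * i).+1; last first.
  rewrite [X in _ <= X]gammaPoly_sym ?(ltnW id) //.
  rewrite [X in X <= _]gammaPoly_sym //.
  have -> : (d - i = (d - i.+1).+1)%N by lia.
  by apply: gammaPoly_incr => //; lia.
rewrite [X in X <= _]gammaPoly_sym //; have -> : (d - i.+1 = i)%N by lia.
by [].
Qed.

End Gamma.

(** * The gamma expansion of the descent polynomial *)

Section Assembly.

Variables (R : realType) (n : nat).
Hypothesis n_gt0 : (0 < n)%N.

(** The number of parking functions without consecutive weak descents that have
    i weak descents. *)
Definition tildeCount (i : nat) : R :=
  #|[set rho in PFtilde n | wdes rho == i]|%:R.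

Lemma sum_PFtilde_gammaPoly :
  \sum_(rho in PFtilde n)
    'X^(wdes rho) * ('X + 1) ^+ (n - 2 * wdes rho - 1)
  = gammaPoly n.-1 tildeCount.
Proof.
pose h (rho : {ffun 'I_n -> 'I_n}) : 'I_(n.-1./2.+1) := inord (wdes rho).
have hE rho : rho \in PFtilde n -> h rho = wdes rho :> nat.
  by move=> /(wdes_PFtilde n_gt0) wn; rewrite inordK //; lia.
rewrite /gammaPoly big_mkord (partition_big h xpredT) //=.
apply: eq_bigr => i _; rewrite /tildeCount scaler_nat -sumr_const.
apply: eq_big => [rho | rho /andP[rp /eqP <-]].
  rewrite inE; case: (boolP (_ \in PFtilde n)) => //= rp.
  by rewrite -val_eqE /= hE.
by rewrite hE //; congr (_ * _ ^+ _); lia.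
Qed.

(** The identity permutation is counted. *)
Lemma tildeCount0_gt0 : 0 < tildeCount 0.
Proof.
rewrite /tildeCount ltr0n; apply/card_gt0P.
pose rho : {ffun 'I_n -> 'I_n} := [ffun i => i].
have eE i : (i <= n)%N -> entry rho i = i.
  case: i => // i lt_in.
  rewrite /entry /= (nth_map (Ordinal lt_in)) ?size_enum_ord // ffunE.
  by rewrite nth_enum_ord.
exists rho; rewrite !inE -andbA; apply/and3P; split.
- apply/forallP => k; apply/implyP => _.
  have wI : injective (widen_ord (leq_ord k)).
    by move=> i j /(congr1 val) /= ij; apply: val_inj.
  rewrite -[X in (X <= _)%N](card_ord k) -(card_imset _ wI).
  apply/subset_leq_card/subsetP => _ /imsetP[i _ ->].
  by rewrite inE ffunE; exact: (ltn_ord i).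
- rewrite -all_predC; apply/allP => i /mem_iota1 /andP[i0 iN] /=.
  have i1 : (i.-1 <= n)%N by lia.
  by rewrite (eE i iN) (eE i.-1 i1); have -> : (i <= i.-1)%N = false by lia.
- rewrite /wdes -leqn0 leqNgt -has_count -all_predC.
  apply/allP => i /mem_iota1 /andP[i0 iN] /=.
  by rewrite !eE ?ltnn // ltnW.
Qed.

End Assembly.

Theorem theorem1p5 (R : realType) (n : nat) (hn : (1 <= n)%N) :
  [/\ \sum_(rho in NT n) 'X^(des rho) =
        \sum_(rho in PFtilde n)
          'X^(wdes rho) * ('X + 1) ^+ (n - 2 * wdes rho - 1) :> {poly R},
      gamma_positive (\sum_(rho in NT n) 'X^(des rho) : {poly R})
    & unimodal (\sum_(rho in NT n) 'X^(des rho) : {poly R})].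
Proof.
have E := sum_NT_PFtilde R hn.
split; first exact: E.
  rewrite E sum_PFtilde_gammaPoly //; apply: gamma_positive_gammaPoly => [|i].
    exact: tildeCount0_gt0.
  exact: ler0n.
rewrite E sum_PFtilde_gammaPoly //; apply: unimodal_gammaPoly => [|i].
  exact: tildeCount0_gt0.
exact: ler0n.
Qed.
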